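(* Assume $g$ is separable, $g(x)=\sum_{j=1}^dg_j(x^{(j)})$, and that $h^*$ is $\mu_h$-strongly convex with $\mu_h>0$. Assume every column of $A$ is nonzero and let $\pi^{(j)}=|I(j)|/n$. Run the sparse PURE-CD algorithm (described in the context) with $$\tilde\tau_0=\frac{\mu_h}{n\max_i\|A_i\|^2},\qquad \tilde\sigma_0=\frac1{2n-1},\qquad \sigma_k^{(i)}=\sigma_k\ \text{ for all } i,$$ $$\tilde\tau_{k+1}=\tilde\tau_k\sqrt{1+\tilde\sigma_k},\quad \tau_k^{(j)}=\frac{\tilde\tau_k}{\pi^{(j)}},\quad \tilde\sigma_{k+1}=\frac{\tilde\sigma_k}{\sqrt{1+\tilde\sigma_k}},\quad \sigma_k=\frac{n\tilde\sigma_k}{\mu_h-(n-1)\mu_h\tilde\sigma_k},\quad \theta_k^{(j)}=\pi^{(j)}n.$$ Then for every $\varepsilon>0$, $\mathbb{E}\left[\|y_K-y_\star\|^2\right]\le\varepsilon$ for every integer $K\ge1$ satisfying $$K\ge 6n\sqrt{\frac{D_\star}{\varepsilon}}\,\max\left(\frac{\max_i\|A_i\|}{\mu_h},1\right),$$ with expected complexity $$O\left(\mathrm{nnz}(A)+\mathrm{nnz}(A)\sqrt{\frac{D_\star}{\varepsilon}}\,\max\left(\frac{\max_i\|A_i\|}{\mu_h},1\right)\right).$$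
   Context: Problem: $\min_{x\in\mathbb{R}^d}\max_{y\in\mathbb{R}^n} L(x,y)$ with $L(x,y)=\langle Ax,y\rangle-h^*(y)+g(x)$, where $A\in\mathbb{R}^{n\times d}$ has rows $A_1,\dots,A_n$, $g:\mathbb{R}^d\to(-\infty,+\infty]$ and $h^*:\mathbb{R}^n\to(-\infty,+\infty]$ are proper convex lower semicontinuous, and $h^*(y)=\sum_{i=1}^n h_i^*(y^{(i)})$ is separable (superscript $(i)$ denotes the $i$-th coordinate). It is assumed that a saddle point $(x_\star,y_\star)$ exists: $L(x,y_\star)\ge L(x_\star,y_\star)\ge L(x_\star,y)$ for all $x,y$; $y_\star$ denotes the dual part of a saddle point (unique when $h^*$ is strongly convex). A convex $f$ is $\mu$-strongly convex if $f(u)\ge f(v)+\langle q,u-v\rangle+\frac\mu2\|u-v\|^2$ for all $u,v$ and $q\in\partial f(v)$. Notation: $\|\cdot\|$ is the Euclidean norm; $\mathrm{nnz}(A)$ is the number of nonzero entries of $A$; $J(i)=\{j:A_{i,j}\ne0\}$, $I(j)=\{i:A_{i,j}\neq0\}$. $\mathrm{prox}_{\tau,f}(x)=\arg\min_u\{f(u)+\frac1{2\tau}|u-x|^2\}$ for scalar $\tau>0$. $D_\star=\min(\|x_\star-x_0\|^2+\|y_\star-y_0\|^2)$ over all saddle points $(x_\star,y_\star)$. Sparse PURE-CD algorithm: start from deterministic $x_0\in\mathrm{dom}\,g$, $y_0\in\mathrm{dom}\,h^*$. Given positive step sizes $\tau_k^{(j)},\sigma_k^{(i)},\theta_k^{(j)}$,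 for $k=0,1,\dots$: 1. pick $i_k\in\{1,\dots,n\}$ uniformly at random, independently of the past; 2. $\bar x_{k+1}^{(j)}=\mathrm{prox}_{\tau_k^{(j)},g_j}\big(x_k^{(j)}-\tau_k^{(j)}(A^\top y_k)^{(j)}\big)$ for $j\in J(i_k)$; 3. $y_{k+1}^{(i_k)}=\mathrm{prox}_{\sigma_k^{(i_k)},h_{i_k}^*}\big(y_k^{(i_k)}+\sigma_k^{(i_k)}A_{i_k}\bar x_{k+1}\big)$ (only the coordinates of $\bar x_{k+1}$ in $J(i_k)$ matter), and $y_{k+1}^{(i)}=y_k^{(i)}$ for $i\ne i_k$; 4. $x_{k+1}^{(j)}=\bar x_{k+1}^{(j)}-\tau_k^{(j)}\theta_k^{(j)}A_{i_k,j}(y_{k+1}^{(i_k)}-y_k^{(i_k)})$ for $j\in J(i_k)$, and $x_{k+1}^{(j)}=x_k^{(j)}$ for $j\notin J(i_k)$. Complexity convention: the expected complexity is the number of iterations $K$ multiplied by the expected cost per iteration $\frac1n\mathrm{nnz}(A)$ (iteration $k$ costs $O(|J(i_k)|)$), plus $O(\mathrm{nnz}(A))$ for computing $A^\top y_0$. *)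

(* Defs.v *)
From HB Require Import structures.
From mathcomp Require Import all_boot all_order all_algebra.
From mathcomp Require Import all_classical all_reals all_analysis.

Set Implicit Arguments.
Unset Strict Implicit.
Unset Printing Implicit Defensive.

Import Order.TTheory GRing.Theory Num.Theory.
Import numFieldNormedType.Exports.

Local Open Scope classical_set_scope.
Local Open Scope ring_scope.

(* Euclidean structure on column vectors: the library norm on matrices is the
   max norm, hence a separate name. *)
Definition dot (R : realType) (m : nat) (u v : 'cV[R]_m) : R :=
  \sum_(i < m) u i 0 * v i 0.

Definition enorm (R : realType) (m : nat) (u : 'cV[R]_m) : R :=
  Num.sqrt (dot u u).

Definition eproper (R : realType) (m : nat) (f : 'cV[R]_m -> \bar R) : Prop :=
  (forall x, f x <> -oo%E) /\ (exists x, (f x < +oo)%E).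

(* Meant for functions that never take the value -oo (0 * +oo is 0 here). *)
Definition econvex (R : realType) (m : nat) (f : 'cV[R]_m -> \bar R) : Prop :=
  forall (x y : 'cV[R]_m) (t : R), 0 <= t <= 1 ->
    (f (t *: x + (1 - t) *: y)%R <= t%:E * f x + (1 - t)%:E * f y)%E.

Definition proper_convex_lsc (R : realType) (m : nat)
    (f : 'cV[R]_m -> \bar R) : Prop :=
  [/\ eproper f, econvex f & lower_semicontinuous f].

(* For proper f the set is empty at points v with f v = +oo. *)
Definition subdifferential (R : realType) (m : nat) (f : 'cV[R]_m -> \bar R)
    (v : 'cV[R]_m) : set 'cV[R]_m :=
  [set q | forall u, (f v + (dot q (u - v))%:E <= f u)%E].

Definition strongly_convex (R : realType) (m : nat) (mu : R)
    (f : 'cV[R]_m -> \bar R) : Prop :=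
  econvex f /\
  forall u v q : 'cV[R]_m, subdifferential f v q ->
    (f v + (dot q (u - v))%:E + (mu / 2 * enorm (u - v) ^+ 2)%:E <= f u)%E.

Definition separable (R : realType) (m : nat) (f : 'cV[R]_m -> \bar R)
    (fs : 'I_m -> R -> \bar R) : Prop :=
  forall x : 'cV[R]_m, f x = (\sum_(j < m) fs j (x j 0%R))%E.

Section problem.
Context {R : realType} {n d : nat}.
Implicit Types (A : 'M[R]_(n, d)) (x : 'cV[R]_d) (y : 'cV[R]_n).
Implicit Types (g : 'cV[R]_d -> \bar R) (hstar : 'cV[R]_n -> \bar R).

(* When g x = hstar y = +oo this evaluates to -oo.  For proper g and hstar the
   points of a saddle pair are in the domains, so [is_saddle] only compares
   values of L for which at most one of the two terms is infinite. *)
Definition lagrangian A g hstar x y : \bar R :=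
  ((dot (A *m x) y)%:E - hstar y + g x)%E.

Definition is_saddle A g hstar xs ys : Prop :=
  forall x y,
    (lagrangian A g hstar xs ys <= lagrangian A g hstar x ys)%E /\
    (lagrangian A g hstar xs y <= lagrangian A g hstar xs ys)%E.

(* The infimum is a minimum: the set of saddle points is closed. *)
Definition Dstar A g hstar x0 y0 : R :=
  inf [set D | exists xs ys, is_saddle A g hstar xs ys /\
                 D = enorm (xs - x0) ^+ 2 + enorm (ys - y0) ^+ 2].

Definition rowsupp A (i : 'I_n) : {set 'I_d} := [set j | A i j != 0]%SET.
Definition colsupp A (j : 'I_d) : {set 'I_n} := [set i | A i j != 0]%SET.
Definition nnz A : nat := #|[set ij : 'I_n * 'I_d | A ij.1 ij.2 != 0]%SET|.
Definition maxrow A : R := \big[Num.max/0]_(i < n) enorm (row i A)^T.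

Definition prox (tau : R) (f : R -> \bar R) (x : R) : R :=
  get [set u | forall v, (f u + ((2 * tau)^-1 * `|u - x| ^+ 2)%:E
                          <= f v + ((2 * tau)^-1 * `|v - x| ^+ 2)%:E)%E].

(* One iteration with sampled row i and the step sizes tau, sigma, theta of
   that iteration. *)
Definition purecd_step A (gs : 'I_d -> R -> \bar R) (hs : 'I_n -> R -> \bar R)
    (tau : 'I_d -> R) (sigma : 'I_n -> R) (theta : 'I_d -> R) (i : 'I_n)
    (xy : 'cV[R]_d * 'cV[R]_n) : 'cV[R]_d * 'cV[R]_n :=
  let x := xy.1 in
  let y := xy.2 in
  let xbar j := prox (tau j) (gs j) (x j 0 - tau j * (A^T *m y) j 0) in
  let yi := prox (sigma i) (hs i)
              (y i 0 + sigma i * \sum_(j in rowsupp A i) A i j * xbar j) in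
  (\col_j (if j \in rowsupp A i
           then xbar j - tau j * theta j * A i j * (yi - y i 0)
           else x j 0),
   \col_l (if l == i then yi else y l 0)).

Fixpoint purecd A (gs : 'I_d -> R -> \bar R) (hs : 'I_n -> R -> \bar R)
    (tau : nat -> 'I_d -> R) (sigma : nat -> 'I_n -> R)
    (theta : nat -> 'I_d -> R) (x0 : 'cV[R]_d) (y0 : 'cV[R]_n)
    (i : nat -> 'I_n) (k : nat) : 'cV[R]_d * 'cV[R]_n :=
  if k is k'.+1 then
    purecd_step A gs hs (tau k') (sigma k') (theta k') (i k')
      (purecd A gs hs tau sigma theta x0 y0 i k')
  else (x0, y0).

Definition colprob A (j : 'I_d) : R := #|colsupp A j|%:R / n%:R.

Fixpoint tilde_steps A (muh : R) (k : nat) : R * R :=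
  if k is k'.+1 then
    let: (t, s) := tilde_steps A muh k' in
    (t * Num.sqrt (1 + s), s / Num.sqrt (1 + s))
  else (muh / (n%:R * maxrow A ^+ 2), (2 * n%:R - 1)^-1).

Definition tau_step A (muh : R) (k : nat) (j : 'I_d) : R :=
  (tilde_steps A muh k).1 / colprob A j.

Definition sigma_step A (muh : R) (k : nat) (i : 'I_n) : R :=
  let s := (tilde_steps A muh k).2 in
  n%:R * s / (muh - (n%:R - 1) * muh * s).

Definition theta_step A (k : nat) (j : 'I_d) : R := colprob A j * n%:R.

(* c is the constant hidden in "an iteration costs O(|J(i_k)|)" and in
   "computing A^T y_0 costs O(nnz A)". *)
Definition run_cost (c : nat) A (i : nat -> 'I_n) (K : nat) : R :=
  (c * nnz A)%:R + \sum_(k < K) (c * #|rowsupp A (i k)|)%:R.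

Definition expected_complexity (c : nat) A (K : nat) : R :=
  K%:R * (c%:R * ((nnz A)%:R / n%:R)) + c%:R * (nnz A)%:R.

(* The number of iterations charged is the least integer K >= 1 with
   r <= K (r being nonnegative). *)
Definition least_iter (r : R) : nat := maxn 1 `|Num.ceil r|%N.

End problem.

(* The 'I_n-valued random variables i_0, i_1, ... are measurable, uniform and
   mutually independent. *)
Definition iid_uniform (R : realType) (disp : measure_display)
    (T : measurableType disp) (P : probability T R) (n : nat)
    (i : nat -> T -> 'I_n) : Prop :=
  [/\ forall (k : nat) (B : set 'I_n), measurable (i k @^-1` B),
      forall (k : nat) (a : 'I_n), P (i k @^-1` [set a]) = (n%:R^-1)%:E
    & forall (s : seq nat) (B : nat -> set 'I_n), uniq s ->
        P (\bigcap_(k in [set` s]) (i k @^-1` B k)) =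
        (\prod_(k <- s) P (i k @^-1` B k))%E].

(* Main.v *)
(**
Write [N = n], [M = maxrow A], [t_k], [s_k] for the two tilde sequences and
[kappa = max (M / mu) 1].  Pairing the optimality conditions of the proximal
steps with the subgradients [-A^T y*] and [A x*] at a saddle point, and averaging
over the sampled row, shows that
  [V_k = |x_k - x*|^2 + mu (t_k / s_k) |y_k - y*|^2]
is a supermartingale: the extrapolation weights [theta] are exactly those for
which the cross terms cancel, and the quadratic error [t_k^2 N^2 |A_i|^2] is
absorbed because [t_k s_k] is constant and [s_k <= s_0].  Since [1 / s_k] gains
at least [1/3] per iteration, [s_K <= 3 / K], whence
  [E |y_K - y*|^2 <= (6 N kappa / K)^2 (|x* - x_0|^2 + |y* - y_0|^2)].
Strong convexity makes [y*] common to all saddle points, so the bound passes to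
the infimum defining [Dstar].
*)
Require Import Defs.
From HB Require Import structures.
From mathcomp Require Import all_boot all_order all_algebra.
From mathcomp Require Import all_classical all_reals all_analysis.
From mathcomp Require Import ring lra.

Set Implicit Arguments.
Unset Strict Implicit.
Unset Printing Implicit Defensive.

Import Order.TTheory GRing.Theory Num.Theory.
Import numFieldNormedType.Exports.

Local Open Scope classical_set_scope.
Local Open Scope ring_scope.

(** * Lower semicontinuous minimisation and the scalar proximal map *)

(** The sublevel sets of [f] on [K] at real levels above the infimum form a proper filter base. At a
    cluster point the value cannot exceed the infimum: lower semicontinuity would keep a
    neighbourhood disjoint from some sublevel set. *)
Lemma lsc_compact_min (R : realType) (T : topologicalType) (K : set T)
    (f : T -> \bar R) (p : T) :
  lower_semicontinuous f -> compact K -> K p ->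
  exists2 u, K u & forall v, K v -> (f u <= f v)%E.
Proof.
move=> flsc cK Kp; set m := ereal_inf (f @` K).
have mle v : K v -> (m <= f v)%E by move=> Kv; apply: ereal_inf_lbound; exists v.
(* With infimum [+oo] no real level lies above it and the filter base would be empty. *)
have [moo|/eqP mNoo] := eqVneq m +oo%E.
  exists p => // v Kv; have := mle _ Kv; rewrite moo leye_eq => /eqP ->.
  exact: leey.
pose D := [set r : R | (m < r%:E)%E].
pose B r := K `&` [set v | (f v < r%:E)%E].
have D0 : exists r, D r.
  move: mNoo; rewrite /D; case: m {mle D} => [r| |] // _.
    by exists (r + 1); rewrite /= lte_fin ltrDl.
  by exists 0; rewrite /= ltNyr.
have FF : ProperFilter (filter_from D B).
  apply: filter_from_proper.
    apply: filter_from_filter => // r s Dr Ds; exists (Num.min r s).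
      by rewrite /D /= EFin_min lt_min Dr.
    move=> v [Kv]; rewrite /= EFin_min lt_min => /andP[vr vs].
    by split; split.
  move=> r Dr; have [_ [v Kv <-] vr] := ereal_inf_lt Dr.
  by exists v; split.
have FK : filter_from D B K by case: D0 => r Dr; exists r => // v [].
have [u [Ku clu]] := cK _ FF FK.
exists u => // v Kv; apply: le_trans (mle _ Kv); rewrite leNgt; apply/negP => mu.
have [r /andP[mr ru]] : exists r : R, (m < r%:E < f u)%E.
  move: mu mNoo; case: m {mle D B D0 FF FK clu} (f u) => [a| |] [b| |] //= mu _.
  - exists ((a + b) / 2); move: mu; rewrite !lte_fin => ab; lra.
  - by exists (a + 1); rewrite !lte_fin ltrDl ltr01 ltry.
  - by exists (b - 1); rewrite ltNyr lte_fin ltrBlDl ltrDr ltr01.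
  - by exists 0; rewrite ltNyr ltry.
have [V nV Vr] := flsc _ _ ru.
have FB : filter_from D B (B r) by exists r.
have [w [[_ /= wr] Vw]] := clu _ _ FB nV.
by have := lt_trans (Vr _ Vw) wr; rewrite ltxx.
Qed.

Lemma lscD_continuous (R : realType) (T : topologicalType) (f : T -> \bar R)
    (h : T -> R) :
  lower_semicontinuous f -> continuous h ->
  lower_semicontinuous (fun v => f v + (h v)%:E)%E.
Proof.
move=> flsc hc x a afx.
(* [b] splits the margin: near [x], [f] exceeds [b] and [h] exceeds [a - b]. *)
have [b /andP[ab bf]] : exists b : R, (a - h x < b) && (b%:E < f x)%E.
  move: afx; case: (f x) => [r| |] //=.
  - rewrite -EFinD lte_fin => ar; exists ((a - h x + r) / 2).
    rewrite lte_fin; lra.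
  - by exists (a - h x + 1); rewrite ltrDl ltr01 ltry.
have [V nV Vb] := flsc _ _ bf.
have nW : nbhs x [set v | a - b < h v].
  apply: (hc x [set t : R | a - b < t]).
  by apply: open_nbhs_nbhs; split; [exact: open_gt|rewrite /=; lra].
exists (V `&` [set v | a - b < h v]); first exact: filterI.
move=> v [Vv /= hv]; have := Vb _ Vv; case: (f v) => [r| |] //=.
  by rewrite -EFinD !lte_fin => br; lra.
by move=> _; rewrite ltry.
Qed.

(** [prox] is chosen by [get], so a minimiser must be shown to exist. The affine minorant touching
    [f] at [p] keeps the penalised function above its value at [p] far from [p], which leaves a
    compact segment. *)
Lemma prox_min (R : realType) (f : R -> \bar R) (p q a tau x : R) :
  0 < tau -> lower_semicontinuous f -> f p = a%:E ->
  (forall v, ((a + q * (v - p))%:E <= f v)%E) ->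
  let u := prox tau f x in
  forall v, (f u + ((2 * tau)^-1 * `|u - x| ^+ 2)%:E
             <= f v + ((2 * tau)^-1 * `|v - x| ^+ 2)%:E)%E.
Proof.
move=> tau0 flsc fp minor; rewrite /prox; case: xgetP => [u _ //|noMin].
set c := (2 * tau)^-1 in noMin *.
have c0 : 0 < c by rewrite invr_gt0; lra.
have hc : continuous (fun v : R => c * `|v - x| ^+ 2).
  move=> v; apply: cvgM; first exact: cvg_cst.
  apply: (@continuous_comp _ _ _ (fun v : R => `|v - x|) (fun t : R => t ^+ 2)).
    by apply: cvg_norm; apply: cvgB; [exact: cvg_id|exact: cvg_cst].
  exact: exprn_continuous.
have plsc := lscD_continuous flsc hc.
(* Beyond this distance from [p], the square [(v - p) ^+ 2] dominates the term linear in [v - p]. *)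
pose B := `|q / c + 2 * (p - x)|.
have Kp : `[p - B, p + B]%classic p.
  by rewrite /= in_itv /= gerBl lerDl normr_ge0.
have [u _ umin] := lsc_compact_min plsc (@segment_compact _ (p - B) (p + B)) Kp.
case: (noMin u) => v.
have [vK|vK] := boolP (v \in `[p - B, p + B]); first exact: umin.
apply: (le_trans (umin _ Kp)); rewrite fp.
apply: (@le_trans _ _ ((a + q * (v - p))%:E + (c * `|v - x| ^+ 2)%:E)%E); last first.
  by rewrite leeD2r.
rewrite -!EFinD lee_fin !real_normK ?num_real//.
have vB : B <= `|v - p|.
  by move: vK; rewrite in_itv/= -ler_distlC -ltNge distrC => /ltW.
have -> : q = c * (q / c) by rewrite mulrC divfK// gt_eqF.
rewrite -subr_ge0.
have -> : a + c * (q / c) * (v - p) + c * (v - x) ^+ 2 - (a + c * (p - x) ^+ 2) =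
  c * ((v - p) ^+ 2 + (q / c + 2 * (p - x)) * (v - p)) by ring.
apply: mulr_ge0; first exact: ltW.
have : `|(q / c + 2 * (p - x)) * (v - p)| <= (v - p) ^+ 2.
  rewrite normrM -(real_normK (num_real (v - p))) expr2.
  by apply: ler_wpM2r.
by rewrite ler_norml => /andP[]; lra.
Qed.

(* For [mu = 0] this is monotonicity of the subdifferential between [p] and the
   proximal point. *)
Lemma prox_mono (R : realType) (f : R -> \bar R) (mu p q a tau x : R) :
  0 < tau -> lower_semicontinuous f -> f p = a%:E ->
  (forall v, ((a + q * (v - p))%:E <= f v)%E) ->
  (forall u v b c t : R, f u = b%:E -> f v = c%:E -> 0 <= t <= 1 ->
     (f (t * u + (1 - t) * v)%R <= (t * b + (1 - t) * c)%:E)%E) ->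
  (forall v b s : R, f v = b%:E -> (forall u, ((b + s * (u - v))%:E <= f u)%E) ->
     b + s * (p - v) + mu / 2 * (p - v) ^+ 2 <= a) ->
  ((x - prox tau f x) / tau - q) * (p - prox tau f x) +
    mu / 2 * (p - prox tau f x) ^+ 2 <= 0.
Proof.
move=> tau0 flsc fp minor conv strong; set u := prox tau f x.
have umin := prox_min x tau0 flsc fp minor.
rewrite -/u in umin.
have [b fu] : exists b, f u = b%:E.
  have := umin p; have := minor u; rewrite fp.
  by case: (f u) => [b| |] //; exists b.
(* First-order condition at the minimiser [u]: otherwise a move of fraction [t] towards a violating
   [v] gains order [t] and costs order [t ^+ 2]. *)
have sub v : ((b + (x - u) / tau * (v - u))%:E <= f v)%E.
  case fv : (f v) => [c| |]; last 2 first.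
  - by rewrite leey.
  - by have := minor v; rewrite fv.
  rewrite lee_fin leNgt; apply/negP => lt.
  set e := b + (x - u) / tau * (v - u) - c.
  have e0 : 0 < e by rewrite /e; lra.
  have key t : 0 <= t <= 1 -> t * e <= t ^+ 2 * ((2 * tau)^-1 * (v - u) ^+ 2).
    move=> t01; have := conv _ _ _ _ _ fv fu t01.
    have := umin (t * v + (1 - t) * u).
    rewrite fu; case: (f (t * v + _)) => [r| |] //.
    rewrite -!EFinD !lee_fin !real_normK ?num_real// => h1 h2.
    have {h1 h2} := le_trans h1 (lerD h2 (lexx _)).
    rewrite -subr_ge0 => h; rewrite -subr_ge0; apply: (le_trans h).
    rewrite le_eqVlt; apply/orP; left; apply/eqP; rewrite /e; field.
    by rewrite gt_eqF.
  set w := (2 * tau)^-1 * (v - u) ^+ 2 in key.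
  have w0 : 0 <= w by rewrite mulr_ge0 ?sqr_ge0// invr_ge0; lra.
  (* This positive [t] satisfies [t * w < e], which contradicts [key]. *)
  have := key (e / (e + w + 1)); have d0 : 0 < e + w + 1 by lra.
  have t01 : 0 <= e / (e + w + 1) <= 1.
    apply/andP; split; first by apply: divr_ge0; apply: ltW.
    by rewrite ler_pdivrMr// mul1r; lra.
  move=> /(_ t01); set t := e / _.
  have t0 : 0 < t by rewrite divr_gt0.
  rewrite expr2 -mulrA ler_pM2l// /t mulrAC ler_pdivlMr//.
  rewrite ler_pM2l//; lra.
have := strong _ _ _ fu sub.
have := minor u; rewrite fu lee_fin; lra.
Qed.

(** * Euclidean norm and one-coordinate updates *)

Lemma enorm_sqr (R : realType) (m : nat) (u : 'cV[R]_m) : enorm u ^+ 2 = dot u u.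
Proof. by rewrite sqr_sqrtr// sumr_ge0// => i _; rewrite -expr2 sqr_ge0. Qed.

Lemma enorm_sqrE (R : realType) (m : nat) (u : 'cV[R]_m) :
  enorm u ^+ 2 = \sum_(i < m) u i 0 ^+ 2.
Proof. by rewrite enorm_sqr; apply: eq_bigr => i _; rewrite expr2. Qed.

Definition upd (R : realType) (m : nat) (p : 'cV[R]_m) (i : 'I_m) (v : R) :
  'cV[R]_m := \col_l (if l == i then v else p l 0).

Lemma dot_upd (R : realType) (m : nat) (q p : 'cV[R]_m) (i : 'I_m) (v : R) :
  dot q (upd p i v - p) = q i 0 * (v - p i 0).
Proof.
rewrite /dot (bigD1 i)//= big1 ?addr0 => [|l li]; first by rewrite !mxE eqxx.
by rewrite !mxE (negPf li) subrr mulr0.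
Qed.

(** * Separable functions along a coordinate line *)

Section separable_coordinates.
Variables (R : realType) (m : nat) (f : 'cV[R]_m -> \bar R).
Variables (fs : 'I_m -> R -> \bar R).
Hypothesis (fP : proper_convex_lsc f) (fsep : separable f fs).

Lemma coord_fin (p : 'cV[R]_m) : f p \is a fin_num ->
  exists phi : 'I_m -> R, forall l, fs l (p l 0) = (phi l)%:E.
Proof.
rewrite fsep => /sum_fin_numP fin; exists (fun l => fine (fs l (p l 0))) => l.
by rewrite fineK// fin// mem_index_enum.
Qed.

Variables (p : 'cV[R]_m) (phi : 'I_m -> R).
Hypothesis pphi : forall l, fs l (p l 0) = (phi l)%:E.

(** On the coordinate line through [p] the other terms add up to a real constant; cancelling it
    transfers properties of [f] to [fs i]. *)
Lemma sep_upd i v :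
  f (upd p i v) = (fs i v + (\sum_(l < m | l != i) phi l)%:E)%E.
Proof.
rewrite fsep (bigD1 i)//= mxE eqxx -sumEFin; congr (_ + _)%E.
by apply: eq_bigr => l li; rewrite mxE (negPf li).
Qed.

Lemma sep_at i : f p = (phi i + \sum_(l < m | l != i) phi l)%:E.
Proof.
rewrite fsep (bigD1 i)//= pphi EFinD -sumEFin; congr (_ + _)%E.
by apply: eq_bigr => l _.
Qed.

Lemma coord_lsc i : lower_semicontinuous (fs i).
Proof.
move=> v b bv; have [_ _ flsc] := fP.
have : ((b + \sum_(l < m | l != i) phi l)%:E < f (upd p i v))%E.
  by rewrite sep_upd EFinD lteD2rE.
move=> /flsc[V nV Vf]; exists (upd p i @^-1` V); last first.
  by move=> w /Vf; rewrite sep_upd EFinD lteD2rE.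
move/nbhs_ballP : nV => [e e0 eV]; apply/nbhs_ballP; exists e => // w vw.
apply: eV; split=> // l j; rewrite !mxE; case: ifP => // _.
exact: ballxx.
Qed.

Lemma coord_convex i (u v b c t : R) :
  fs i u = b%:E -> fs i v = c%:E -> 0 <= t <= 1 ->
  (fs i (t * u + (1 - t) * v)%R <= (t * b + (1 - t) * c)%:E)%E.
Proof.
move=> fu fv t01; have [_ fconv _] := fP.
have := fconv (upd p i u) (upd p i v) t t01.
have -> : t *: upd p i u + (1 - t) *: upd p i v =
          upd p i (t * u + (1 - t) * v).
  by apply/colP => l; rewrite !mxE; case: ifP => // _; ring.
rewrite !sep_upd fu fv -!EFinD; set S := \sum_(_ < _ | _) _.
have -> : t * (b + S) + (1 - t) * (c + S) = (t * b + (1 - t) * c) + S by ring.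
by rewrite EFinD leeD2rE.
Qed.

Variable (q : 'cV[R]_m).
Hypothesis qsub : subdifferential f p q.

Lemma coord_subgrad i v : ((phi i + q i 0 * (v - p i 0))%:E <= fs i v)%E.
Proof.
have := qsub (upd p i v); rewrite dot_upd sep_upd (sep_at i).
rewrite -EFinD addrAC EFinD; set S := \sum_(_ < _ | _) _.
by rewrite leeD2rE.
Qed.

(* Changing the [i]-th coordinate of both the point and its subgradient again
   gives a subgradient, so strong convexity passes to each coordinate. *)
Lemma coord_strong mu i (v b s : R) : strongly_convex mu f ->
  fs i v = b%:E -> (forall u, ((b + s * (u - v))%:E <= fs i u)%E) ->
  b + s * (p i 0 - v) + mu / 2 * (p i 0 - v) ^+ 2 <= phi i.
Proof.
move=> [_ fstrong] fv sv.
have qv : subdifferential f (upd p i v) (upd q i s).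
  move=> u; rewrite sep_upd fv -!EFinD (fsep u) [X in (_ <= X)%E](bigD1 i)//=.
  apply: (@le_trans _ _ ((b + s * (u i 0 - v))%:E +
      \sum_(l < m | l != i) (phi l + q l 0 * (u l 0 - p l 0))%:E)%E); last first.
    by apply: leeD; [exact: sv|apply: lee_sum => l _; exact: coord_subgrad].
  have -> : dot (upd q i s) (u - upd p i v) =
      s * (u i 0 - v) + \sum_(l < m | l != i) q l 0 * (u l 0 - p l 0).
    rewrite /dot (bigD1 i)//= !mxE eqxx; congr (_ + _).
    by apply: eq_bigr => l li; rewrite !mxE (negPf li).
  by rewrite sumEFin -EFinD lee_fin big_split/= addrACA.
have := fstrong p _ _ qv.
rewrite enorm_sqr.
have -> : p - upd p i v = - (upd p i v - p) by rewrite opprB.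
have dotN (x y : 'cV[R]_m) : dot x (- y) = - dot x y.
  by rewrite /dot -sumrN; apply: eq_bigr => l _; rewrite mxE mulrN.
rewrite !dotN !dot_upd sep_upd fv (sep_at i).
rewrite -!EFinD lee_fin !mxE eqxx; lra.
Qed.

Lemma coord_prox_mono mu i (tau x : R) : strongly_convex mu f -> 0 < tau ->
  ((x - prox tau (fs i) x) / tau - q i 0) * (p i 0 - prox tau (fs i) x) +
    mu / 2 * (p i 0 - prox tau (fs i) x) ^+ 2 <= 0.
Proof.
move=> fstrong tau0; apply: (@prox_mono R (fs i) mu (p i 0) (q i 0) (phi i)) => //.
- exact: coord_lsc.
- exact: coord_subgrad.
- exact: coord_convex.
- by move=> v b s fv sv; apply: coord_strong.
Qed.

End separable_coordinates.

(** * Optimality conditions and dual uniqueness at saddle points *)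

Section saddle.
Variables (R : realType) (n d : nat) (A : 'M[R]_(n, d)).
Variables (g : 'cV[R]_d -> \bar R) (h : 'cV[R]_n -> \bar R).
Hypotheses (gP : eproper g) (hP : eproper h).

(** Comparison with one point of each domain excludes every infinite case, including both values
    being [+oo], where the Lagrangian evaluates to [-oo]. *)
Lemma saddle_fin xs ys : is_saddle A g h xs ys ->
  g xs \is a fin_num /\ h ys \is a fin_num.
Proof.
move=> sad; have [gN [x1 gx1]] := gP; have [hN [y1 hy1]] := hP.
have := sad x1 y1; rewrite /lagrangian.
have := gN xs; have := hN ys; have := gN x1; have := hN y1.
move: gx1 hy1; case: (g x1) => [a1| |] //; case: (h y1) => [b1| |] //.
by case: (g xs) => [a| |] //; case: (h ys) => [b| |] // _ _ _ _ _ _ [].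
Qed.

Lemma saddle_sub xs ys : is_saddle A g h xs ys ->
  subdifferential g xs (- (A^T *m ys)) /\ subdifferential h ys (A *m xs).
Proof.
move=> sad; have [gf hf] := saddle_fin sad.
have dotA x : dot (A *m x) ys = dot (A^T *m ys) x.
  rewrite /dot; under eq_bigr do rewrite mxE mulr_suml.
  rewrite exchange_big/=; apply: eq_bigr => j _; rewrite mxE mulr_suml.
  by apply: eq_bigr => i _; rewrite mxE; ring.
move: gf hf sad; rewrite /is_saddle /lagrangian.
case gxs : (g xs) => [a| |] //; case hys : (h ys) => [b| |] // _ _ sad.
split=> u.
  have [+ _] := sad u ys; have := gP.1 u; rewrite gxs.
  case: (g u) => [c _| _ _|//]; last by rewrite leey.
  rewrite -!EFinN -!EFinD !lee_fin !dotA.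
  have -> : dot (- (A^T *m ys)) (u - xs) =
            dot (A^T *m ys) xs - dot (A^T *m ys) u.
    by rewrite /dot -sumrB; apply: eq_bigr => j _; rewrite !mxE; ring.
  by move: (dot _ _) (dot _ _) => p q; lra.
have [_ +] := sad xs u; have := hP.1 u; rewrite hys.
case: (h u) => [c _| _ _|//]; last by rewrite leey.
rewrite -!EFinN -!EFinD !lee_fin.
have -> : dot (A *m xs) (u - ys) = dot (A *m xs) u - dot (A *m xs) ys.
  by rewrite /dot -sumrB; apply: eq_bigr => j _; rewrite !mxE; ring.
by move: (dot _ _) (dot _ _) => p q; lra.
Qed.

(** In the sum of the four subgradient inequalities between the two points, function values and
    bilinear terms cancel; strong convexity at [ys] leaves [mu / 2 * enorm (ys' - ys) ^+ 2 <= 0]. *)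
Lemma saddle_dual_unique mu xs ys xs' ys' : 0 < mu -> strongly_convex mu h ->
  is_saddle A g h xs ys -> is_saddle A g h xs' ys' -> ys' = ys.
Proof.
move=> mu0 [_ hstr] sad sad'.
have [gf hf] := saddle_fin sad; have [gf' hf'] := saddle_fin sad'.
have [gs_ hs_] := saddle_sub sad; have [gs' hs'] := saddle_sub sad'.
have := gs_ xs'; have := gs' xs; have := hstr ys' _ _ hs_; have := hs' ys.
move: gf hf gf' hf'.
case: (g xs) => [a| |] //; case: (h ys) => [b| |] //.
case: (g xs') => [a'| |] //; case: (h ys') => [b'| |] // _ _ _ _.
rewrite -!EFinD !lee_fin => h1 h2 h3 h4.
have cross : dot (A *m xs') (ys - ys') + dot (A *m xs) (ys' - ys)
   + dot (- (A^T *m ys')) (xs - xs') + dot (- (A^T *m ys)) (xs' - xs) = 0.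
  have dotA x y : dot (- (A^T *m y)) x = - dot (A *m x) y.
    rewrite /dot; under [in RHS]eq_bigr do rewrite mxE mulr_suml.
    rewrite exchange_big/= -sumrN; apply: eq_bigr => j _.
    rewrite !mxE mulNr mulr_suml; congr (- _).
    by apply: eq_bigr => i _; rewrite mxE; ring.
  rewrite !dotA !mulmxBr /dot -!sumrN -!big_split/= big1// => i _.
  by rewrite !mxE; ring.
have e0 : enorm (ys' - ys) ^+ 2 <= 0.
  have : mu / 2 * enorm (ys' - ys) ^+ 2 <= mu / 2 * 0 by lra.
  by rewrite ler_pM2l//; lra.
apply/colP => i; apply/eqP; rewrite -subr_eq0.
have : (ys' - ys) i 0 ^+ 2 <= 0.
  apply: le_trans e0; rewrite enorm_sqrE (bigD1 i)//= lerDl.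
  by apply: sumr_ge0 => l _; rewrite sqr_ge0.
by rewrite exprn_even_le0//= !mxE.
Qed.

End saddle.

(** * One iteration, summed over the sampled row *)

Lemma row_sum_supp (R : realType) (n d : nat) (A : 'M[R]_(n, d)) (i : 'I_n)
    (z : 'I_d -> R) :
  \sum_(j in rowsupp A i) A i j * z j = \sum_j A i j * z j.
Proof.
rewrite [RHS](bigID (mem (rowsupp A i)))/= [X in _ + X]big1 ?addr0// => j.
by rewrite inE negbK => /eqP ->; rewrite mul0r.
Qed.

Section one_step.
Variables (R : realType) (n d : nat) (A : 'M[R]_(n, d)).
Variables (gs : 'I_d -> R -> \bar R) (hs : 'I_n -> R -> \bar R).
Variables (t s mu : R) (xs : 'cV[R]_d) (ys : 'cV[R]_n).
Let N : R := n%:R.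
Let tau j := t / colprob A j.
Let sigma (i : 'I_n) := N * s / (mu - (N - 1) * mu * s).
Let theta j := colprob A j * N.
Hypothesis n0 : (0 < n)%N.
Hypothesis col0 : forall j : 'I_d, exists l : 'I_n, A l j != 0.
Hypotheses (t0 : 0 < t) (s0 : 0 < s) (mu0 : 0 < mu) (s1 : (N - 1) * s < 1).
Hypothesis gprox : forall j z,
  ((z - prox (tau j) (gs j) z) / tau j - (- (A^T *m ys)) j 0) *
    (xs j 0 - prox (tau j) (gs j) z) <= 0.
Hypothesis hprox : forall i z,
  ((z - prox (sigma i) (hs i) z) / sigma i - (A *m xs) i 0) *
    (ys i 0 - prox (sigma i) (hs i) z) +
    mu / 2 * (ys i 0 - prox (sigma i) (hs i) z) ^+ 2 <= 0.
Hypothesis stepsize :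
  forall i, t * N * (\sum_j A i j ^+ 2) <= mu / N * (s^-1 - (N - 1)).

Let N0 : 0 < N. Proof. by rewrite ltr0n. Qed.

Lemma colprob_gt0 j : 0 < colprob A j.
Proof.
rewrite divr_gt0// ltr0n; have [l Al] := col0 j.
by apply/card_gt0P; exists l; rewrite inE.
Qed.

Variables (x : 'cV[R]_d) (y : 'cV[R]_n).
(** Defined for every index: [xb] does not depend on the sampled row, and [yb i] is the dual value
    produced when row [i] is drawn. *)
Let xb j := prox (tau j) (gs j) (x j 0 - tau j * (A^T *m y) j 0).
Let yb i := prox (sigma i) (hs i)
  (y i 0 + sigma i * \sum_(j in rowsupp A i) A i j * xb j).
Let xp a := (purecd_step A gs hs tau sigma theta a (x, y)).1.
Let yp a := (purecd_step A gs hs tau sigma theta a (x, y)).2.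

(** The column probability cancels in [tau j * theta j], leaving the common coefficient [t * N]. *)
Lemma xpE a j : xp a j 0 =
  if A a j != 0 then xb j - t * N * A a j * (yb a - y a 0) else x j 0.
Proof.
rewrite /xp /purecd_step/= mxE inE; case: eqP => //= _.
rewrite -/(xb j) -/(yb a) /tau /theta mulrA divfK//.
by rewrite gt_eqF// colprob_gt0.
Qed.

Lemma ypE a i : yp a i 0 = if i == a then yb a else y i 0.
Proof. by rewrite /yp /purecd_step/= mxE. Qed.

Lemma step_primal j :
  \sum_a ((xp a) j 0 - xs j 0) ^+ 2 <=
  N * (x j 0 - xs j 0) ^+ 2
  - 2 * t * N * (xb j - xs j 0) * (\sum_a A a j * (yb a - ys a 0))
  + t ^+ 2 * N ^+ 2 * \sum_a A a j ^+ 2 * (yb a - y a 0) ^+ 2.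
Proof.
have pi0 := colprob_gt0 j.
(* Exact expansion: [colprob A j * N] counts the rows that touch column [j]; the others keep the old
   distance. *)
have -> : \sum_a ((xp a) j 0 - xs j 0) ^+ 2 =
    colprob A j * N * ((xb j - xs j 0) ^+ 2 - (x j 0 - xs j 0) ^+ 2)
    + N * (x j 0 - xs j 0) ^+ 2
    - 2 * t * N * (xb j - xs j 0) * (\sum_a A a j * (yb a - y a 0))
    + t ^+ 2 * N ^+ 2 * \sum_a A a j ^+ 2 * (yb a - y a 0) ^+ 2.
  have -> : colprob A j * N = \sum_a (if a \in colsupp A j then 1 else 0).
    by rewrite -big_mkcond/= sumr_const /colprob divfK// gt_eqF.
  have -> : N * (x j 0 - xs j 0) ^+ 2 = \sum_(a < n) (x j 0 - xs j 0) ^+ 2.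
    by rewrite sumr_const card_ord -mulr_natl.
  rewrite mulr_suml !mulr_sumr -sumrN -!big_split/=.
  apply: eq_bigr => a _; rewrite xpE inE; case: eqP => [->|_] /=; ring.
have := gprox j (x j 0 - tau j * (A^T *m y) j 0); rewrite -/(xb j).
have -> : \sum_a A a j * (yb a - y a 0) =
  \sum_a A a j * (yb a - ys a 0) - (A^T *m y) j 0 + (A^T *m ys) j 0.
  by rewrite !mxE -sumrN -!big_split/=; apply: eq_bigr => a _; rewrite !mxE; ring.
move: (\sum_a A a j * (yb a - ys a 0)) => S.
move: (\sum_a A a j ^+ 2 * (yb a - y a 0) ^+ 2) => Q.
rewrite [(- (A^T *m ys)) j 0]mxE.
move: ((A^T *m y) j 0) ((A^T *m ys) j 0) => a b.
move: (xb j) (x j 0) (xs j 0) => u v w.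
have -> : ((v - tau j * a - u) / tau j - - b) * (w - u) =
  t^-1 * (colprob A j * (v - u) * (w - u) - t * (a - b) * (w - u)).
  by rewrite /tau; field; rewrite ?gt_eqF// .
rewrite pmulr_rle0 ?invr_gt0// => le0.
have sq : 0 <= colprob A j * (v - u) ^+ 2 by rewrite mulr_ge0 ?sqr_ge0// ltW.
rewrite -subr_ge0; set X := (X in 0 <= X).
have -> : X = N * (colprob A j * (v - u) ^+ 2 -
  2 * (colprob A j * (v - u) * (w - u) - t * (a - b) * (w - u))).
  by rewrite /X; ring.
apply: mulr_ge0; first exact: ltW.
by lra.
Qed.

(** Coordinate [i] moves for one row out of [N] and stays put for [N - 1], hence the weights on the
    left. [sigma] is chosen so that the coefficients of [(y i 0 - ys i 0) ^+ 2] balance. *)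
Lemma step_dual i :
  mu * (t / s * (1 + s)) *
    ((yb i - ys i 0) ^+ 2 + (N - 1) * (y i 0 - ys i 0) ^+ 2) <=
  N * (mu * (t / s) * (y i 0 - ys i 0) ^+ 2)
  - t ^+ 2 * N ^+ 2 * (\sum_j A i j ^+ 2) * (yb i - y i 0) ^+ 2
  + 2 * t * N * (\sum_j A i j * (xb j - xs j 0)) * (yb i - ys i 0).
Proof.
have := hprox i (y i 0 + sigma i * \sum_(j in rowsupp A i) A i j * xb j).
rewrite -/(yb i) row_sum_supp.
have -> : \sum_j A i j * (xb j - xs j 0) =
    \sum_j A i j * xb j - (A *m xs) i 0.
  by rewrite mxE -sumrB; apply: eq_bigr => j _; ring.
have := stepsize i.
move: (\sum_j A i j ^+ 2) (\sum_j A i j * xb j) ((A *m xs) i 0) => M2 P Q.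
move: (yb i) (y i 0) (ys i 0) => u v w.
have d0 : mu - (N - 1) * mu * s != 0.
  by rewrite gt_eqF// mulrAC -{1}[mu]mul1r -mulrBl mulr_gt0// subr_gt0.
have Ns : N != 0 by rewrite gt_eqF.
have ss : s != 0 by rewrite gt_eqF.
(* [nu] is the inverse of [sigma i]. *)
set nu := mu / N * (s^-1 - (N - 1)).
have -> : (v + sigma i * P - u) / sigma i - Q = nu * (v - u) + P - Q.
  by rewrite /sigma /nu; field; rewrite d0 Ns ss.
move=> hM h.
have h1 : 0 <= t * N * (u - v) ^+ 2 * (nu - t * N * M2).
  by rewrite mulr_ge0 ?subr_ge0// mulr_ge0 ?sqr_ge0// mulr_ge0// ltW.
have h2 : 0 <= t * N * - ((nu * (v - u) + P - Q) * (w - u) + mu / 2 * (w - u) ^+ 2).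
  by apply: mulr_ge0; [apply: mulr_ge0; exact: ltW|rewrite oppr_ge0].
rewrite -subr_ge0; set X := (X in 0 <= X).
(* The gap is exactly the step-size slack plus twice the weighted slack of the proximal
   inequality. *)
have -> : X = t * N * (u - v) ^+ 2 * (nu - t * N * M2) + 2 *
  (t * N * - ((nu * (v - u) + P - Q) * (w - u) + mu / 2 * (w - u) ^+ 2)).
  by rewrite /X /nu; field; rewrite Ns ss.
by lra.
Qed.

(** Summing [step_primal] over columns and [step_dual] over rows cancels the bilinear terms ([e1])
    and the quadratic errors ([e2], [e3]). The factor [N] appears because rows are summed, not
    averaged. *)
Lemma step_descent :
  \sum_a (enorm (xp a - xs) ^+ 2 +
          mu * (t / s * (1 + s)) * enorm (yp a - ys) ^+ 2) <=
  N * (enorm (x - xs) ^+ 2 + mu * (t / s) * enorm (y - ys) ^+ 2).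
Proof.
rewrite big_split/= -mulr_sumr.
under eq_bigr do rewrite enorm_sqrE.
have -> : \sum_a enorm (yp a - ys) ^+ 2 =
    \sum_i ((yb i - ys i 0) ^+ 2 + (N - 1) * (y i 0 - ys i 0) ^+ 2).
  under eq_bigr do rewrite enorm_sqrE.
  rewrite exchange_big/=; apply: eq_bigr => i _.
  under eq_bigr do rewrite mxE ypE [(- ys) _ _]mxE.
  rewrite (bigD1 i)//= eqxx; congr (_ + _).
  rewrite (eq_bigr (fun=> (y i 0 - ys i 0) ^+ 2)) => [|a ai]; last first.
    by rewrite eq_sym (negPf ai).
  rewrite sumr_const cardC1 card_ord -[_ *+ _]mulr_natl; congr (_ * _).
  by rewrite -subn1 natrB.
rewrite exchange_big/= !enorm_sqrE [N * _]mulrDr !mulr_sumr.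
apply: (@le_trans _ _ (\sum_j (N * (x j 0 - xs j 0) ^+ 2
    - 2 * t * N * (xb j - xs j 0) * (\sum_a A a j * (yb a - ys a 0))
    + t ^+ 2 * N ^+ 2 * \sum_a A a j ^+ 2 * (yb a - y a 0) ^+ 2) +
  \sum_i (N * (mu * (t / s) * (y i 0 - ys i 0) ^+ 2)
    - t ^+ 2 * N ^+ 2 * (\sum_j A i j ^+ 2) * (yb i - y i 0) ^+ 2
    + 2 * t * N * (\sum_j A i j * (xb j - xs j 0)) * (yb i - ys i 0)))).
  apply: lerD; apply: ler_sum => j _; last exact: step_dual.
  apply: le_trans (step_primal j).
  by apply: ler_sum => a _; rewrite mxE [(- xs) _ _]mxE.
rewrite !big_split/= -!mulr_sumr.
have -> : \sum_i (x - xs) i 0 ^+ 2 = \sum_i (x i 0 - xs i 0) ^+ 2.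
  by apply: eq_bigr => i _; rewrite !mxE.
have -> : \sum_i (y - ys) i 0 ^+ 2 = \sum_i (y i 0 - ys i 0) ^+ 2.
  by apply: eq_bigr => i _; rewrite !mxE.
have e1 : \sum_j - (2 * t * N * (xb j - xs j 0) * (\sum_a A a j * (yb a - ys a 0)))
  + \sum_i 2 * t * N * (\sum_j A i j * (xb j - xs j 0)) * (yb i - ys i 0) = 0.
  rewrite sumrN addrC; apply/eqP; rewrite subr_eq0; apply/eqP.
  under eq_bigr do rewrite mulr_sumr mulr_suml.
  rewrite exchange_big/=; apply: eq_bigr => j _; rewrite mulr_sumr.
  by apply: eq_bigr => i _; ring.
have e2 : \sum_j \sum_a A a j ^+ 2 * (yb a - y a 0) ^+ 2 =
    \sum_i (\sum_j A i j ^+ 2) * (yb i - y i 0) ^+ 2.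
  by rewrite exchange_big/=; apply: eq_bigr => i _; rewrite mulr_suml.
have e3 : \sum_i - (t ^+ 2 * N ^+ 2 * (\sum_j A i j ^+ 2) * (yb i - y i 0) ^+ 2)
   = - (t ^+ 2 * N ^+ 2 * \sum_i (\sum_j A i j ^+ 2) * (yb i - y i 0) ^+ 2).
  by rewrite mulr_sumr -sumrN; apply: eq_bigr => i _; ring.
by rewrite e2 e3; lra.
Qed.

End one_step.

(** * Expectations over uniform samples as finite averages *)

Section uniform_average.
Variables (R : realType) (n : nat).

(** The last row is averaged first, as in conditioning on the earlier samples; the supermartingale
    bound is then a plain induction. *)
Fixpoint avg (K : nat) (F : seq 'I_n -> R) : R :=
  if K is K'.+1 then avg K' (fun s => n%:R^-1 * \sum_a F (rcons s a))
  else F [::].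

Fixpoint allseqs (K : nat) : seq (seq 'I_n) :=
  if K is K'.+1 then [seq rcons s a | s <- allseqs K', a <- index_enum 'I_n]
  else [:: [::]].

Lemma le_avg K F G : (forall s, size s = K -> F s <= G s) -> avg K F <= avg K G.
Proof.
elim: K F G => [|K IH] F G FG /=; first exact: FG.
apply: IH => s sK; apply: ler_wpM2l; first by rewrite invr_ge0.
by apply: ler_sum => a _; apply: FG; rewrite size_rcons sK.
Qed.

Lemma eq_avg K F G : (forall s, size s = K -> F s = G s) -> avg K F = avg K G.
Proof. by move=> FG; apply/le_anti; rewrite !le_avg// => s /FG ->. Qed.

Lemma avg_supermartingale (V : nat -> seq 'I_n -> R) K :
  (forall s, n%:R^-1 * \sum_a V (size s).+1 (rcons s a) <= V (size s) s) ->
  avg K (V K) <= V 0%N [::].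
Proof.
move=> VP; elim: K => //= K; apply: le_trans.
by apply: le_avg => s <-; exact: VP.
Qed.

Lemma avgE K F : avg K F = \sum_(s <- allseqs K) n%:R^-1 ^+ K * F s.
Proof.
elim: K F => [|K IH] F /=; first by rewrite big_seq1 mul1r.
rewrite IH big_allpairs_dep; apply: eq_bigr => s _.
by rewrite mulrA -exprSr mulr_sumr.
Qed.

Lemma size_allseqs K s : s \in allseqs K -> size s = K.
Proof.
elim: K s => [|K IH] s /=; first by rewrite inE => /eqP ->.
by move=> /allpairsP[[u a] [/= /IH <- _ ->]]; rewrite size_rcons.
Qed.

(** Exactly one term survives. This turns a function of the first [K] samples into a finite
    combination of indicators. *)
Lemma allseqs_decomp (f : nat -> 'I_n) K (F : seq 'I_n -> R) :
  F (mkseq f K) = \sum_(s <- allseqs K) F s * (mkseq f K == s)%:R.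
Proof.
elim: K F => [|K IH] F /=; first by rewrite big_seq1 mulr1.
rewrite big_allpairs_dep mkseqS (IH (fun s => F (rcons s (f K)))).
apply: eq_bigr => s _; rewrite (bigD1 (f K))//= eqseq_rcons eqxx andbT.
rewrite big1 ?addr0// => a /negPf aK.
by rewrite eqseq_rcons [f K == a]eq_sym aK andbF mulr0.
Qed.

Lemma expectation_avg (disp : measure_display) (T : measurableType disp)
    (P : probability T R) (i : nat -> T -> 'I_n) (K : nat) (F : seq 'I_n -> R) :
  (0 < n)%N -> iid_uniform P i -> (forall s, 0 <= F s) ->
  ('E_P[fun w => F (mkseq (fun k => i k w) K)] = (avg K F)%:E)%E.
Proof.
move=> n0 [imeas iunif iind] F0.
pose a0 := Ordinal n0.
pose E s := \bigcap_(k in [set` iota 0 K]) (i k @^-1` [set nth a0 s k]).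
have mE s : measurable (E s).
  by apply: fin_bigcap_measurable => // k _; exact: imeas.
have inE' s w : size s = K -> (\1_(E s) w : R) = (mkseq (fun k => i k w) K == s)%:R.
  move=> sK; rewrite indicE; congr (_%:R); apply: congr1; apply/idP/eqP.
    rewrite inE => Ew; apply: (@eq_from_nth _ a0); rewrite size_mkseq// => k kK.
    by rewrite nth_mkseq//; apply: Ew; rewrite /= mem_iota.
  move=> ws; rewrite inE => k /=; rewrite mem_iota => kK.
  by rewrite -ws nth_mkseq.
have PE s : P (E s) = (n%:R^-1 ^+ K)%:E.
  rewrite iind ?iota_uniq//; under eq_bigr do rewrite iunif.
  (* Peeling off one factor shifts the start of [iota], so the start is generalised to [m]. *)
  elim: K {E mE inE'} 0%N => [|K IH] m; first by rewrite big_nil expr0.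
  by rewrite big_cons IH -EFinM exprS.
rewrite unlock.
transitivity (\int[P]_w \sum_(s <- allseqs K) ((F s)%:E * (\1_(E s) w)%:E))%E.
  apply: eq_integral => w _; rewrite (allseqs_decomp _ K F) -sumEFin.
  by apply: eq_big_seq => s /size_allseqs sK; rewrite EFinM inE'.
rewrite ge0_integral_sum//=.
- rewrite avgE -sumEFin; apply: eq_bigr => s _.
  rewrite ge0_integralZl_EFin//=.
  + by rewrite integral_indic// setIT [X in (_ * X)%E](PE s) -EFinM mulrC.
  + by apply/measurable_realfun.measurable_EFinP; exact: measurable_realfun.measurable_indic.
- move=> s; apply: measurable_funeM.
  by apply/measurable_realfun.measurable_EFinP; exact: measurable_realfun.measurable_indic.
- by move=> s w _; rewrite mule_ge0// lee_fin.
Qed.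

End uniform_average.

(** * The step-size sequences *)

Section step_sizes.
Variables (R : realType) (n d : nat) (A : 'M[R]_(n, d)) (mu : R).
Hypotheses (n0 : (0 < n)%N) (mu0 : 0 < mu) (M0 : 0 < maxrow A).
Let N : R := n%:R.
Let M : R := maxrow A.
Let t k := (tilde_steps A mu k).1.
Let s k := (tilde_steps A mu k).2.

Let N1 : 1 <= N. Proof. by rewrite ler1n. Qed.
Let N0 : 0 < N. Proof. by rewrite ltr0n. Qed.
Let N21 : 0 < 2 * N - 1. Proof. by have := N1; lra. Qed.

Lemma tilde_stepsS k :
  t k.+1 = t k * Num.sqrt (1 + s k) /\ s k.+1 = s k / Num.sqrt (1 + s k).
Proof. by rewrite /t /s /=; case: (tilde_steps A mu k). Qed.

Lemma tilde_steps_gt0 k : 0 < t k /\ 0 < s k.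
Proof.
elim: k => [|k [tk sk]].
  split; rewrite /t /s /=.
    by rewrite divr_gt0// mulr_gt0 ?exprn_gt0.
  by rewrite invr_gt0.
have [-> ->] := tilde_stepsS k.
have u0 : 0 < Num.sqrt (1 + s k) by rewrite sqrtr_gt0; lra.
by split; [exact: mulr_gt0|exact: divr_gt0].
Qed.

(** The factor [1 + s k] is the growth of the dual weight in [step_descent], so consecutive
    iterations chain. *)
Lemma tilde_steps_ratioS k : t k.+1 / s k.+1 = t k / s k * (1 + s k).
Proof.
have [tk sk] := tilde_steps_gt0 k; have [-> ->] := tilde_stepsS k.
have u2 : Num.sqrt (1 + s k) ^+ 2 = 1 + s k by rewrite sqr_sqrtr//; lra.
have u0 : 0 < Num.sqrt (1 + s k) by rewrite sqrtr_gt0; lra.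
by rewrite -[in RHS]u2; field; rewrite !gt_eqF.
Qed.

Lemma tilde_steps_prod k : t k * s k = mu / (N * M ^+ 2 * (2 * N - 1)).
Proof.
elim: k => [|k IH].
  by rewrite /t /s /= -/N -/M (invfM (N * M ^+ 2)) (mulrA mu).
have [tk sk] := tilde_steps_gt0 k; have [-> ->] := tilde_stepsS k.
have u0 : 0 < Num.sqrt (1 + s k) by rewrite sqrtr_gt0; lra.
by rewrite -IH; field; rewrite gt_eqF.
Qed.

(** As [s k <= 1], the root [Num.sqrt (1 + s k)] is at least [1 + s k / 3]; dividing by [s k] adds
    at least [1 / 3] to the inverse. *)
Lemma tilde_sigma_inv_ge k : 2 * N - 1 + k%:R / 3 <= (s k)^-1.
Proof.
elim: k => [|k IH]; first by rewrite /s /= invrK mul0r addr0.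
have [tk sk] := tilde_steps_gt0 k; have [_ ->] := tilde_stepsS k.
have k0 : 0 <= k%:R / 3 :> R by rewrite mulr_ge0 // invr_ge0.
have N1' := N1; have s1 : s k <= 1.
  by rewrite -[s k]invrK invf_le1 ?invr_gt0//; lra.
have u1 : 1 + s k / 3 <= Num.sqrt (1 + s k).
  have <- : Num.sqrt ((1 + s k / 3) ^+ 2) = 1 + s k / 3.
    by rewrite sqrtr_sqr ger0_norm//; lra.
  by apply: ler_wsqrtr; nra.
rewrite invf_div -[k.+1%:R]natr1 (mulrDl k%:R) addrA.
apply: (@le_trans _ _ ((1 + s k / 3) / s k)).
  have h1 : (1 + s k / 3) / s k = (s k)^-1 + 1 / 3 by field; rewrite gt_eqF.
  by rewrite h1; lra.
by rewrite ler_pM2r// invr_gt0.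
Qed.

(** This makes the denominator in [sigma_step] positive. *)
Lemma tilde_sigma_lt1 k : (N - 1) * s k < 1.
Proof.
have [_ sk] := tilde_steps_gt0 k; have := tilde_sigma_inv_ge k.
have k0 : 0 <= k%:R / 3 :> R by rewrite mulr_ge0 // invr_ge0.
move=> h; rewrite -ltr_pdivlMr// mul1r; have := N1; lra.
Qed.

Lemma row_sqr_le i : \sum_j A i j ^+ 2 <= M ^+ 2.
Proof.
have -> : \sum_j A i j ^+ 2 = enorm (row i A)^T ^+ 2.
  by rewrite enorm_sqrE; apply: eq_bigr => j _; rewrite !mxE.
rewrite lerXn2r ?nnegrE ?sqrtr_ge0// ?(ltW M0)//.
exact: (le_bigmax _ (fun i => enorm (row i A)^T)).
Qed.

(* The right-hand side is [1 / sigma_k]; both sides agree at [k = 0] when row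
   [i] attains the maximum. *)
Lemma tilde_stepsize k i :
  t k * N * (\sum_j A i j ^+ 2) <= mu / N * ((s k)^-1 - (N - 1)).
Proof.
have [tk sk] := tilde_steps_gt0 k; have := tilde_sigma_inv_ge k.
have k0 : 0 <= k%:R / 3 :> R by rewrite mulr_ge0 // invr_ge0.
have N1' := N1; move=> h; apply: (@le_trans _ _ (t k * N * M ^+ 2)).
  by rewrite ler_pM2l ?row_sqr_le// mulr_gt0//; lra.
have -> : t k * N * M ^+ 2 = mu * (s k)^-1 / (2 * N - 1).
  have -> : t k = mu / (N * M ^+ 2 * (2 * N - 1)) / s k.
    by rewrite -(tilde_steps_prod k) mulfK// gt_eqF.
  field; rewrite !gt_eqF//; lra.
have -> : mu / N * ((s k)^-1 - (N - 1)) = mu * ((s k)^-1 - (N - 1)) / N by ring.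
rewrite ler_pdivrMr; last lra.
rewrite mulrAC ler_pdivlMr; last lra.
rewrite -!mulrA ler_pM2l//.
(* After clearing denominators, the claim is the nonnegativity of this product. *)
have : 0 <= (N - 1) * ((s k)^-1 - (2 * N - 1)) by rewrite mulr_ge0//; lra.
by lra.
Qed.

End step_sizes.

(** * Expected cost, and dependence on finitely many samples *)

Lemma maxrow_gt0 (R : realType) (n d : nat) (A : 'M[R]_(n, d)) i j :
  A i j != 0 -> 0 < maxrow A.
Proof.
move=> Aij; apply: lt_le_trans (le_bigmax _ (fun i => enorm (row i A)^T) i).
rewrite sqrtr_gt0 -enorm_sqr enorm_sqrE (bigD1 j)//= ltr_pwDl//.
  by rewrite !mxE lt_neqAle sqr_ge0 andbT eq_sym sqrf_eq0.
by apply: sumr_ge0 => l _; rewrite sqr_ge0.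
Qed.

Lemma nnzE (R : realType) (n d : nat) (A : 'M[R]_(n, d)) :
  nnz A = (\sum_(a < n) #|rowsupp A a|)%N.
Proof.
under [RHS]eq_bigr do rewrite -sum1_card.
rewrite pair_big_dep/= /nnz -sum1_card; apply: eq_bigl => -[a j].
by rewrite !inE.
Qed.

Lemma avg_additive (R : realType) (n K : nat) (c0 : R) (phi : 'I_n -> R) a0 :
  (0 < n)%N ->
  avg K (fun s => c0 + \sum_(k < K) phi (nth a0 s k)) =
  c0 + K%:R * (n%:R^-1 * \sum_a phi a).
Proof.
move=> n0; have nn0 : n%:R != 0 :> R by rewrite pnatr_eq0 -lt0n.
set m := n%:R^-1 * \sum_a phi a.
elim: K c0 => [|K IH] c0 /=; first by rewrite big_ord0 mul0r.
(* The mean [m] of the last term is absorbed into the constant, which is why the induction keeps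
   [c0] general. *)
rewrite -natr1 mulrDl mul1r (addrC _ m) addrA -IH; apply: eq_avg => s sK.
under eq_bigr => a _.
  rewrite big_ord_recr/= nth_rcons sK ltnn eqxx.
  under eq_bigr => k _ do rewrite nth_rcons sK ltn_ord.
  over.
have nK z : n%:R^-1 * (z *+ n) = z :> R by rewrite -(mulr_natl z) mulKf.
rewrite !big_split/= !sumr_const card_ord !mulrDr !nK -/m; ring.
Qed.

Lemma expected_cost (R : realType) (disp : measure_display)
    (T : measurableType disp) (P : probability T R) (n d c K : nat)
    (A : 'M[R]_(n, d)) (i : nat -> T -> 'I_n) :
  (0 < n)%N -> iid_uniform P i ->
  ('E_P[fun w => run_cost c A (fun k => i k w) K] =
     (expected_complexity c A K)%:E)%E.
Proof.
move=> n0 iidi; pose a0 := Ordinal n0.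
pose F s : R := run_cost c A (nth a0 s) K.
have -> : (fun w => run_cost c A (fun k => i k w) K) =
          (fun w => F (mkseq (fun k => i k w) K)).
  apply/funext => w; rewrite /F /run_cost; congr (_ + _).
  by apply: eq_bigr => k _; rewrite nth_mkseq.
rewrite (expectation_avg _ n0 iidi); last first.
  by move=> s; apply: addr_ge0 => //; apply: sumr_ge0.
congr (_%:E).
rewrite (avg_additive K _ (fun a => (c * #|rowsupp A a|)%:R))//.
rewrite /expected_complexity natrM addrC nnzE; congr (_ * _ + _).
rewrite natr_sum [LHS]mulrC mulrA; congr (_ / _).
by rewrite mulr_sumr; apply: eq_bigr => a _; rewrite natrM.
Qed.

(** Allows an infinite sample path to be replaced by a finite sequence read through [nth]. *)
Lemma purecd_ext (R : realType) (n d : nat) (A : 'M[R]_(n, d)) gs hs tau sigma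
    theta x0 y0 (i i' : nat -> 'I_n) K :
  (forall k, (k < K)%N -> i k = i' k) ->
  purecd A gs hs tau sigma theta x0 y0 i K =
  purecd A gs hs tau sigma theta x0 y0 i' K.
Proof.
elim: K => //= K IH ii'; rewrite ii'// IH// => k kK.
by apply: ii'; rewrite ltnS ltnW.
Qed.

(** Allows [coord_prox_mono] to serve the primal function too, with modulus 0. *)
Lemma strongly_convex0 (R : realType) (m : nat) (f : 'cV[R]_m -> \bar R) :
  econvex f -> strongly_convex 0 f.
Proof.
by move=> fc; split=> // u v q qv; rewrite mul0r mul0r adde0; exact: qv.
Qed.

(** * The Lyapunov function and the dual rate *)

Section convergence.
Variables (R : realType) (n d : nat) (A : 'M[R]_(n, d)).
Variables (g : 'cV[R]_d -> \bar R) (h : 'cV[R]_n -> \bar R).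
Variables (gs : 'I_d -> R -> \bar R) (hs : 'I_n -> R -> \bar R) (mu : R).
Variables (x0 : 'cV[R]_d) (y0 : 'cV[R]_n).
Hypotheses (n0 : (0 < n)%N) (d0 : (0 < d)%N).
Hypotheses (gP : proper_convex_lsc g) (hP : proper_convex_lsc h).
Hypotheses (gsep : separable g gs) (hsep : separable h hs).
Hypotheses (mu0 : 0 < mu) (hstr : strongly_convex mu h).
Hypothesis col0 : forall j : 'I_d, exists l : 'I_n, A l j != 0.
Let N : R := n%:R.
Let M : R := maxrow A.
Let kappa : R := Num.max (M / mu) 1.
Let a0 : 'I_n := Ordinal n0.
Let t k := (tilde_steps A mu k).1.
Let s k := (tilde_steps A mu k).2.
Let run (u : seq 'I_n) k := purecd A gs hs (tau_step A mu) (sigma_step A mu)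
  (theta_step A) x0 y0 (nth a0 u) k.

Let M0 : 0 < M.
Proof. by have [l Al] := col0 (Ordinal d0); exact: maxrow_gt0 Al. Qed.

Let N1 : 1 <= N. Proof. by rewrite ler1n. Qed.

Definition lyapunov (xs : 'cV[R]_d) (ys : 'cV[R]_n) k
    (z : 'cV[R]_d * 'cV[R]_n) : R :=
  enorm (z.1 - xs) ^+ 2 + mu * (t k / s k) * enorm (z.2 - ys) ^+ 2.

Variables (xs : 'cV[R]_d) (ys : 'cV[R]_n).
Hypothesis sad : is_saddle A g h xs ys.

Lemma lyapunov_step k z :
  N^-1 * \sum_a lyapunov xs ys k.+1 (purecd_step A gs hs (tau_step A mu k)
    (sigma_step A mu k) (theta_step A k) a z) <= lyapunov xs ys k z.
Proof.
have [gprop gconv _] := gP; have [hprop _ _] := hP.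
have [gfin hfin] := saddle_fin gprop hprop sad.
have [gsub hsub] := saddle_sub gprop hprop sad.
have [phi gphi] := coord_fin gsep gfin.
have [psi hpsi] := coord_fin hsep hfin.
have [tk sk] := tilde_steps_gt0 n0 mu0 M0 k.
have s1 := tilde_sigma_lt1 n0 mu0 M0 k.
rewrite ler_pdivrMl ?ltr0n//; case: z => x y.
rewrite /lyapunov /t /s tilde_steps_ratioS//.
apply: step_descent => //.
- move=> j z; have := coord_prox_mono gP gsep gphi gsub j z
    (strongly_convex0 gconv) (tau := tau_step A mu k j).
  by rewrite mul0r mul0r addr0; apply; rewrite divr_gt0// colprob_gt0.
- move=> l z; apply: (coord_prox_mono hP hsep hpsi hsub l z hstr).
  rewrite divr_gt0// ?mulr_gt0 ?ltr0n//.
  by rewrite mulrAC -{1}[mu]mul1r -mulrBl mulr_gt0// subr_gt0.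
- by move=> l; exact: tilde_stepsize.
Qed.

Lemma dual_rate K : (0 < K)%N ->
  avg K (fun u => enorm ((run u K).2 - ys) ^+ 2) <=
  (6 * N * kappa / K%:R) ^+ 2 * (enorm (xs - x0) ^+ 2 + enorm (ys - y0) ^+ 2).
Proof.
move=> K0.
have [tK sK] := tilde_steps_gt0 n0 mu0 M0 K.
have sinv := tilde_sigma_inv_ge n0 mu0 M0 K.
have tsK := tilde_steps_prod n0 mu0 M0 K.
rewrite -/(t K) -/(s K) -/N -/M in tK sK sinv tsK.
have K0' : 0 < K%:R :> R by rewrite ltr0n.
have N1' := N1.
have N0 : 0 < N by lra.
have N21 : 0 < 2 * N - 1 by lra.
(* Normalises the dual weight at time [K] to 1, so [w] times the Lyapunov function dominates the
   dual error. *)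
pose w := (mu * (t K / s K))^-1.
have w0 : 0 < w by rewrite invr_gt0 mulr_gt0// divr_gt0.
have wK : w * (mu * (t K / s K)) = 1.
  by rewrite mulVf// gt_eqF// mulr_gt0// divr_gt0.
have enormN m (u v : 'cV[R]_m) : enorm (u - v) ^+ 2 = enorm (v - u) ^+ 2.
  by rewrite !enorm_sqrE; apply: eq_bigr => l _; rewrite !mxE; ring.
pose V k u := w * lyapunov xs ys k (run u k).
apply: (@le_trans _ _ (avg K (V K))).
  apply: le_avg => u _; rewrite /V /lyapunov mulrDr (mulrA w (mu * _)) wK mul1r.
  by rewrite lerDr mulr_ge0 ?sqr_ge0// ltW.
apply: le_trans (@avg_supermartingale _ _ V K _) _.
  move=> u; rewrite /V -mulr_sumr mulrCA ler_pM2l//.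
  apply: le_trans (lyapunov_step (size u) (run u (size u))).
  rewrite ler_pM2l ?invr_gt0//; apply: ler_sum => a _.
  rewrite /run /= nth_rcons ltnn eqxx (@purecd_ext _ _ _ _ _ _ _ _ _ _ _ _ (nth a0 u))//.
  by move=> k ku; rewrite nth_rcons ku.
rewrite /V /run /lyapunov /= (enormN _ x0) (enormN _ y0).
move: (enorm (xs - x0) ^+ 2) (sqr_ge0 (enorm (xs - x0))) => X X0.
move: (enorm (ys - y0) ^+ 2) (sqr_ge0 (enorm (ys - y0))) => Y Y0.
have -> : t 0 / s 0 = mu * (2 * N - 1) / (N * M ^+ 2).
  by rewrite /t /s /= -/N -/M invrK mulrAC.
(* Since [t k * s k] is constant, the ratio of initial to final dual weight is [(s K / s 0) ^+ 2],
   with [s 0] the inverse of [2 * N - 1]. *)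
have -> : w * (X + mu * (mu * (2 * N - 1) / (N * M ^+ 2)) * Y) =
    (s K * (2 * N - 1)) ^+ 2 * (N / (2 * N - 1) * (M / mu) ^+ 2 * X + Y).
  rewrite /w; have -> : t K = mu / (N * M ^+ 2 * (2 * N - 1)) / s K.
    by rewrite -tsK mulfK// gt_eqF.
  by field; rewrite !gt_eqF.
have kM : (M / mu) ^+ 2 <= kappa ^+ 2.
  by rewrite lerXn2r ?nnegrE ?le_max ?lexx ?ler01 ?orbT// divr_ge0// ltW.
have k1 : 1 <= kappa ^+ 2 by rewrite exprn_ege1// le_max lexx orbT.
(* Uses [s K <= 3 / K%:R], [2 * N - 1 <= 2 * N] and [N / (2 * N - 1) <= 1]. *)
apply: (@le_trans _ _ ((6 * N / K%:R) ^+ 2 * (kappa ^+ 2 * X + kappa ^+ 2 * Y))).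
  apply: ler_pM; rewrite ?sqr_ge0//.
  - by rewrite addr_ge0// !mulr_ge0 ?sqr_ge0 ?invr_ge0// ltW.
  - rewrite lerXn2r ?nnegrE ?mulr_ge0 ?invr_ge0 ?(ltW N0) ?(ltW sK) ?(ltW N21)//.
    rewrite ler_pdivlMr// -ler_pdivlMl ?mulr_gt0//.
    rewrite invfM; apply: (@le_trans _ _ ((2 * N - 1 + K%:R / 3) * 3)); first lra.
    have : 3 <= (2 * N - 1)^-1 * (6 * N).
      by rewrite mulrC ler_pdivlMr//; lra.
    move=> h3; rewrite -mulrA; apply: ler_pM => //.
    by rewrite addr_ge0 ?mulr_ge0 ?invr_ge0// ltW.
  - apply: lerD.
      apply: ler_wpM2r => //; apply: le_trans kM.
      rewrite ler_piMl ?sqr_ge0// ler_pdivrMr//; lra.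
    by rewrite ler_peMl.
rewrite le_eqVlt; apply/orP; left; apply/eqP; field.
by rewrite gt_eqF.
Qed.

End convergence.

(** * Iteration count and complexity in terms of [Dstar] *)

Unset Implicit Arguments.
Set Strict Implicit.

Theorem theorem5p2 (c : nat) :
  exists C : nat,
  forall (R : realType) (n d : nat) (A : 'M[R]_(n, d))
    (g : 'cV[R]_d -> \bar R) (hstar : 'cV[R]_n -> \bar R)
    (gs : 'I_d -> R -> \bar R) (hs : 'I_n -> R -> \bar R) (muh : R)
    (x0 : 'cV[R]_d) (y0 : 'cV[R]_n) (xs : 'cV[R]_d) (ys : 'cV[R]_n)
    (disp : measure_display) (T : measurableType disp) (P : probability T R)
    (i : nat -> T -> 'I_n),
    (0 < n)%N -> (0 < d)%N ->
    proper_convex_lsc g -> proper_convex_lsc hstar ->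
    separable g gs -> separable hstar hs ->
    0 < muh -> strongly_convex muh hstar ->
    (forall j : 'I_d, exists l : 'I_n, A l j != 0) ->
    is_saddle A g hstar xs ys ->
    (g x0 < +oo)%E -> (hstar y0 < +oo)%E ->
    iid_uniform P i ->
    let kappa : R := Num.max (maxrow A / muh) 1 in
    let y K w := (purecd A gs hs (tau_step A muh) (sigma_step A muh)
                    (theta_step A) x0 y0 (fun k => i k w) K).2 in
    forall eps : R, 0 < eps ->
      let ratio : R := Num.sqrt (Dstar A g hstar x0 y0 / eps) * kappa in
      (forall K : nat, (1 <= K)%N -> 6 * n%:R * ratio <= K%:R ->
         ('E_P[fun w => (enorm (y K w - ys) ^+ 2)%R] <= eps%:E)%E) /\
      (let K := least_iter (6 * n%:R * ratio) in
       ('E_P[fun w => run_cost c A (fun k => i k w) K] =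
          (expected_complexity c A K)%:E)%E /\
       expected_complexity c A K <=
         C%:R * ((nnz A)%:R + (nnz A)%:R * ratio)).
Proof.
(* The cost is [c * nnz A] times [K / n + 1], and [K / n <= 6 * ratio + 1]. *)
exists (6 * c)%N => R n d A g hstar gs hs muh x0 y0 xs ys disp T P i.
move=> n0 d0 gP hP gsep hsep mu0 hstr col0 sad _ _ iidi kappa y eps eps0 ratio.
have N1 : 1 <= n%:R :> R by rewrite ler1n.
have k1 : 1 <= kappa by rewrite le_max lexx orbT.
have ratio0 : 0 <= ratio by rewrite mulr_ge0 ?sqrtr_ge0//; lra.
split; last first.
  split; first exact: expected_cost.
  set K := least_iter _.
  (* The extra 1 covers both rounding up and the floor of one iteration. *)
  have Kle : K%:R <= 6 * n%:R * ratio + 1.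
    have r0 : 0 <= 6 * n%:R * ratio by apply: mulr_ge0 => //; lra.
    rewrite /K /least_iter; case: (leqP 1 `|Num.ceil (6 * n%:R * ratio)|%N) => _.
      rewrite natr_absz ger0_norm ?ceil_ge0; last lra.
      have := ceilB1_lt (6 * n%:R * ratio); rewrite intrB; lra.
    by lra.
  rewrite /expected_complexity.
  have -> : K%:R * (c%:R * ((nnz A)%:R / n%:R)) + c%:R * (nnz A)%:R =
      c%:R * (nnz A)%:R * (K%:R / n%:R + 1) :> R by ring.
  rewrite natrM.
  have -> : 6%:R * c%:R * ((nnz A)%:R + (nnz A)%:R * ratio) =
      c%:R * (nnz A)%:R * (6 + 6 * ratio) by ring.
  rewrite ler_wpM2l ?mulr_ge0//.
  have : K%:R / n%:R <= 6 * ratio + 1 :> R.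
    rewrite ler_pdivrMr; last lra.
    by apply: (le_trans Kle); lra.
  by lra.
move=> K K1 Kr.
pose a0 := Ordinal n0.
pose F u := enorm ((purecd A gs hs (tau_step A muh) (sigma_step A muh)
  (theta_step A) x0 y0 (nth a0 u) K).2 - ys) ^+ 2.
have -> : (fun w => enorm (y K w - ys) ^+ 2) =
          (fun w => F (mkseq (fun k => i k w) K)).
  apply/funext => w; rewrite /F /y; congr (enorm (_.2 - _) ^+ 2).
  by apply: purecd_ext => k kK; rewrite nth_mkseq.
rewrite (expectation_avg _ n0 iidi); last by move=> u; exact: sqr_ge0.
rewrite lee_fin.
set D := Dstar A g hstar x0 y0 in ratio ratio0 Kr.
have K0 : 0 < K%:R :> R by rewrite ltr0n.
pose B := 6 * n%:R * kappa / K%:R.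
have B0 : 0 < B by rewrite divr_gt0// !mulr_gt0//; lra.
have D0 : 0 <= D.
  apply: lb_le_inf; first by exists (enorm (xs - x0) ^+ 2 + enorm (ys - y0) ^+ 2), xs, ys.
  by move=> _ [xs' [ys' [_ ->]]]; rewrite addr_ge0// sqr_ge0.
(* The left side is below the squared distance for every saddle pair, hence below the infimum; [F]
   stays the same because all pairs share the dual part [ys]. *)
have FD : avg K F / B ^+ 2 <= D.
  apply: lb_le_inf; first by exists (enorm (xs - x0) ^+ 2 + enorm (ys - y0) ^+ 2), xs, ys.
  move=> _ [xs' [ys' [sad' ->]]]; rewrite ler_pdivrMr ?exprn_gt0// mulrC.
  have [hprop _ _] := hP; have [gprop _ _] := gP.
  have yy := saddle_dual_unique gprop hprop mu0 hstr sad sad'.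
  move: sad'; rewrite yy => sad'.
  exact: (dual_rate x0 y0 n0 d0 gP hP gsep hsep mu0 hstr col0 sad' K1).
move: FD; rewrite ler_pdivrMr ?exprn_gt0// => /le_trans; apply.
(* This restates the condition on [K]; its square gives [B ^+ 2 * D <= eps]. *)
have Br : B * Num.sqrt (D / eps) <= 1.
  rewrite /B mulrAC ler_pdivrMr// mul1r; apply: le_trans Kr.
  by rewrite /ratio mulrA mulrAC.
have : (B * Num.sqrt (D / eps)) ^+ 2 <= 1.
  by rewrite expr_le1// mulr_ge0 ?sqrtr_ge0// ltW.
rewrite exprMn sqr_sqrtr; last by rewrite divr_ge0// ltW.
by rewrite mulrA ler_pdivrMr// mul1r mulrC.
Qed.
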